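(* On tadpole graphs in the time model, the ALE-based exploration strategy described below has competitive ratio at most $3$ when run with a team of three agents, and competitive ratio at most $2$ when run with a team of four agents.
   Context: Multi-agent online graph exploration: an undirected connected graph $G=(V,E)$ with positive edge lengths $l(e)$ and distinctly labelled nodes is initially unknown. $k$ agents start at a node $s$; initially they know $s$, its incident edges (with lengths) and its neighbours. Whenever an agent visits a node $v$ for the first time, all edges incident to $v$ (with lengths) and the neighbours of $v$ are revealed. Agents share all information instantly, have unlimited computation, move at unit speed (traversing $e$ takes time $l(e)$), and may wait. The exploration is finished when every node has been visited and all agents are back at $s$. Time model: the cost is the finishing time. $opt(G,s,k)$ is the minimum cost of an exploration by $k$ agents with full prior knowledge of $G$; a strategy has competitive ratio at most $c$ on a class if $\mathrm{cost}(G,s,k)\le c\cdot opt(G,s,k)$ in the supremum sense over all $G$ in the class and $s\in V$. A tadpole graph consists of a cycle together with a path (the tail, at least one edge) attached to one cycle node (the intersection $v_i$, of degree 3); the other tail end $v_t$ has degree 1. The strategy (ALE rule = only the agent (or team) whose next unexplored edge is shortest among all currently visible next edges traverses it, ties broken at random; once all nodes are visited, all agents return to $s$ along shortest paths): if $s=v_t$, two agents go to $v_i$, explore the cycle with the two-agent ALE rule in opposite directions and return; if $s=v_i$, one agent is sent into each of the three directions and they proceed by the ALE rule; if $s$ has degree 2, then with three agents, one agent goes in each of the two directions by the ALE rule while the third waits at $s$ until $v_i$ is discovered, then (the others waiting) it moves to $v_i$ and afterwards all three explore the remaining directions by the ALE rule; with four agents, two teams of two (each team moving together as a single agent) are sent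 in the two directions by the ALE rule, and the team that reaches $v_i$ splits so that every unexplored direction is followed by an agent. *)

(* Defs.v *)
From mathcomp Require Import all_boot all_order all_algebra.
From mathcomp Require Import reals.
Set Implicit Arguments.
Unset Strict Implicit.
Unset Printing Implicit Defensive.
Import Order.TTheory GRing.Theory Num.Theory.
Local Open Scope ring_scope.

Record wgraph (R : realType) := WGraph {
  vertex :> finType;
  edge : rel vertex;
  len : vertex -> vertex -> R;
  edge_sym : symmetric edge;
  edge_irr : irreflexive edge;
  edge_connected : forall x y, connect edge x y;
  len_sym : forall x y, len x y = len y x;
  len_gt0 : forall x y, edge x y -> 0 < len x y }.

Arguments edge {R w}.
Arguments len {R w}.

Section Exploration.
Variables (R : realType) (G : wgraph R).

Definition nbrs (x : G) : {set G} := [set y | edge x y].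

Definition deg (x : G) : nat := #|nbrs x|.

Definition joined (ps : seq (G * G)) (x y : G) : bool :=
  ((x, y) \in ps) || ((y, x) \in ps).

(* [vi :: c] lists the cycle in cyclic order from the intersection [vi], and
   [t] lists the tail without [vi]; the two zips are the lists of consecutive
   pairs of the cycle and of the path [vi :: t]. *)
Definition tadpole : Prop :=
  exists (vi : G) (c t : seq G),
    [/\ uniq (vi :: c ++ t),
        (2 <= size c)%N,
        (1 <= size t)%N,
        forall x, x \in vi :: c ++ t
      & forall x y : G, edge x y =
          joined (zip (vi :: c) (rcons c vi)) x y
          || joined (zip (vi :: t) t) x y].

Inductive action := Move of G | Wait of R.

Fixpoint valid (u : G) (p : seq action) : bool :=
  match p with
  | [::] => true
  | Move v :: p' => edge u v && valid v p'
  | Wait d :: p' => (0 <= d) && valid u p'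
  end.

Fixpoint duration (u : G) (p : seq action) : R :=
  match p with
  | [::] => 0
  | Move v :: p' => len u v + duration v p'
  | Wait d :: p' => d + duration u p'
  end.

Fixpoint trace (u : G) (p : seq action) : seq G :=
  match p with
  | [::] => [::]
  | Move v :: p' => v :: trace v p'
  | Wait _ :: p' => trace u p'
  end.

Definition walk (p : seq G) : seq action := [seq Move v | v <- p].

Definition shortest_walk (D : {set G}) (u v : G) (p : seq G) : Prop :=
  let walks q := [/\ path edge u q, all (mem D) q & last u q = v] in
  walks p /\
  forall q, walks q -> duration u (walk p) <= duration u (walk q).

Variables (s : G) (k : nat).

Definition plan := 'I_k -> seq action.

Definition position (P : plan) (i : 'I_k) : G := last s (trace s (P i)).

Definition visited (P : plan) : {set G} :=
  [set v | (v == s) || [exists i, v \in trace s (P i)]].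

Definition explores (P : plan) : Prop :=
  [/\ forall i, valid s (P i),
      forall i, position P i = s
    & visited P = [set: G]].

(* The time at which the last agent completes its action list.  A plan that
   goes on after all nodes are visited and all agents are back at [s] is charged
   for that; this does not affect the infimum [opt], and the plans of [ale]
   below do not go on in this way. *)
Definition cost (P : plan) : R :=
  \big[Order.max/0]_(i < k) duration s (P i).

Definition opt : R :=
  inf (fun c : R => exists2 P : plan, explores P & c = cost P).

(* [heading st i = Some v] means that agent [i] is to follow the edge from its
   position to [v]; an agent with heading [None] does not explore. *)
Record state := State { history : plan; heading : 'I_k -> option G }.

(* The agents in [A], all standing at [u], walk along [p] while all others
   wait. *)
Definition leg (P : plan) (A : {set 'I_k}) (u : G) (p : seq G) : plan :=
  fun i => P i ++ (if i \in A then walk p else [:: Wait (duration u (walk p))]).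

(* Only edges leading to unvisited nodes count as next unexplored edges: an
   untraversed edge between two visited nodes is never a candidate. *)
Definition next_edge (st : state) (i : 'I_k) (v : G) : Prop :=
  heading st i = Some v /\ v \notin visited (history st).

Definition team (st : state) (i : 'I_k) : {set 'I_k} :=
  [set j | (position (history st) j == position (history st) i)
           && (heading st j == heading st i)].

Definition ale_choice (st : state) (i : 'I_k) (v : G) : Prop :=
  next_edge st i v /\
  forall j w, next_edge st j w ->
    len (position (history st) i) v <= len (position (history st) j) w.

Definition unexplored (P : plan) (v : G) : {set G} := nbrs v :\: visited P.

(* The agents in [A] are distributed over the directions [D], leaving no
   direction of [D] unattended; the other agents keep their heading. *)
Definition spread (A : {set 'I_k}) (D : {set G}) (h h' : 'I_k -> option G) :=
  (forall j, j \notin A -> h' j = h j) /\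
  h' @: A = (if D == set0 then [set None] else Some @: D).

(* One application of the ALE rule.  [Z] is the set of agents waiting at [s]
   for the degree-3 node to be found: when it is reached, they join the agents
   that found it by a shortest walk through visited nodes. *)
Inductive ale_step (Z : {set 'I_k}) (st st' : state) : Prop :=
| AleTraverse i v of
    ale_choice st i v
    & ~~ ((deg v == 3)%N && (Z != set0))
    & history st' = leg (history st) (team st i) (position (history st) i) [:: v]
    & spread (team st i) (unexplored (history st') v) (heading st) (heading st')
| AleTraverseJoin i v p of
    ale_choice st i v
    & (deg v == 3)%N && (Z != set0)
    & (let P := leg (history st) (team st i) (position (history st) i) [:: v] in
       shortest_walk (visited P) s v p /\ history st' = leg P Z s p)
    & spread (team st i :|: Z) (unexplored (history st') v)
        (heading st) (heading st').

(* The number of agents sent together into each direction at [s]: the pair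
   sent along the tail if [s] is the tail end; single agents (three agents) or
   teams of two (four agents) if [s] has degree 2; single agents if [s] is the
   intersection. *)
Definition crew : nat :=
  (match deg s with 1 => 2 | 2 => k./2 | _ => 1 end)%N.

Definition initial (st : state) : Prop :=
  [/\ forall i, history st i = [::],
      forall i v, heading st i = Some v -> edge s v
    & forall v, edge s v -> #|[set i | heading st i == Some v]| = crew].

Definition reserve (st : state) : {set 'I_k} :=
  if (deg s == 2)%N then [set i | heading st i == None] else set0.

Inductive ale_reach (st0 : state) : state -> Prop :=
| AleStart : ale_reach st0 st0
| AleNext st st' of
    ale_reach st0 st & ale_step (reserve st0) st st' : ale_reach st0 st'.

(* A run ends once all nodes are visited.  A run that would get stuck before
   that also ends; it then yields a plan that is not an exploration. *)
Definition ale_end (st0 st : state) : Prop :=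
  visited (history st) = [set: G]
  \/ ~ exists st', ale_step (reserve st0) st st'.

(* The plans that the strategy may carry out, over all ways of breaking ties
   and of distributing the agents. *)
Definition ale (P : plan) : Prop :=
  exists st0 st,
    [/\ initial st0, ale_reach st0 st, ale_end st0 st
      & forall i, exists2 p,
          shortest_walk (visited (history st)) (position (history st) i) s p
          & P i = history st i ++ walk p].

End Exploration.

Definition strategy (R : realType) :=
  forall (G : wgraph R) (s : G) (k : nat), plan G k -> Prop.

Definition competitive_ratio_le (R : realType) (A : strategy R)
    (C : wgraph R -> Prop) (k : nat) (c : R) : Prop :=
  forall (G : wgraph R) (s : G), C G ->
    (exists P, A G s k P) /\
    forall P, A G s k P ->
      explores s P /\ cost s P <= c * opt s k.

(* Main.v *)
Require Import Defs.
From mathcomp Require Import all_boot all_order all_algebra.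
From mathcomp Require Import reals.
From mathcomp Require Import boolp lra zify.

(* At every moment each edge from a visited to an unvisited node is attended by
   an agent, so the ALE rule is Prim's algorithm and the edges it traverses form
   a minimum spanning tree.  Let [M] be the largest distance from [s]; every
   exploration costs at least [2 * M].  A shortest-path tree has at most three
   leaves, since only the intersection [vi] has degree 3; hence it weighs at most
   [3 * M], and so does the ALE tree.  Returning to [s] takes at most [M], which
   gives [4 * M] in all for an even number of agents.  With an odd number of
   agents the reserve's walk to [vi] may come on top; it is no longer than the
   time elapsed when [vi] is found.  Up to then ALE is Prim's algorithm on the
   side of [vi] containing [s], where a shortest-path tree has at most two
   leaves, so that time is at most [2 * M]. *)

Set Implicit Arguments.
Unset Strict Implicit.
Unset Printing Implicit Defensive.
Import Order.TTheory GRing.Theory Num.Theory.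
Local Open Scope ring_scope.

(** * Walks and shortest walks inside a set of vertices *)

Section Walks.
Variables (R : realType) (G : wgraph R).
Implicit Types (u v x y : G) (p q : seq G) (a b : seq (action G)) (D : {set G}).

Lemma trace_cat u a b :
  trace u (a ++ b) = trace u a ++ trace (last u (trace u a)) b.
Proof. by elim: a u => [|[v|d] a IH] u //=; rewrite IH. Qed.

Lemma duration_cat u a b :
  duration u (a ++ b) = duration u a + duration (last u (trace u a)) b.
Proof. by elim: a u => [|[v|d] a IH] u /=; rewrite ?add0r // IH addrA. Qed.

Lemma valid_cat u a b :
  valid u (a ++ b) = valid u a && valid (last u (trace u a)) b.
Proof. by elim: a u => [|[v|d] a IH] u //=; rewrite IH andbA. Qed.

Lemma trace_walk u p : trace u (walk p) = p.
Proof. by elim: p u => //= v p IH u; rewrite IH. Qed.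

Lemma valid_walk u p : valid u (walk p) = path edge u p.
Proof. by elim: p u => //= v p IH u; rewrite IH. Qed.

Lemma walk_cat p q : walk (p ++ q) = walk p ++ walk q :> seq (action G).
Proof. exact: map_cat. Qed.

Lemma duration_ge0 u a : valid u a -> 0 <= duration u a.
Proof.
elim: a u => //= -[v|d] a IH u /andP[h /IH]; last exact: addr_ge0.
by apply: addr_ge0; apply/ltW/len_gt0.
Qed.

(** Cutting out loops never lengthens a walk, since durations of walks are nonnegative. Only walks
    of at most [#|G|] steps then matter. *)
Lemma uniq_walk u p D : path edge u p -> all (mem D) p ->
  exists q, [/\ path edge u q, all (mem D) q, last u q = last u p,
    uniq (u :: q) & duration u (walk q) <= duration u (walk p)].
Proof.
elim: p u => [|a p IH] u /=; first by exists [::].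
move=> /andP[ua /IH{}IH] /andP[aD /IH[q [pq Dq lq uq dq]]].
have [uin|unin] := boolP (u \in a :: q).
  (* The walk returns to [u] after [q1]; this loop is dropped and only [q2] is kept. *)
  case/splitPr E: _ / uin => [q1 q2].
  have lq1 : last u (rcons q1 u) = u by rewrite last_rcons.
  have puaq : path edge u (a :: q) by rewrite /= ua.
  have Daq : all (mem D) (a :: q) by rewrite /= Dq andbT.
  have uaq : uniq (a :: q) by [].
  have daq : duration u (walk (a :: q)) <= len u a + duration a (walk p).
    by rewrite /= lerD2l.
  have laq : last u (a :: q) = last a p by [].
  move: puaq Daq uaq daq laq; rewrite E -cat_rcons cat_path all_cat cat_uniq lq1.
  move=> /andP[p1 p2] /andP[_ D2] /and3P[_ h u2] dd ll.
  exists q2; split => //.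
  - by rewrite -ll last_cat lq1.
  - rewrite /= u2 andbT; apply: contra h => uin; apply/hasP; exists u => //.
    by rewrite mem_rcons inE eqxx.
  apply: le_trans dd; rewrite walk_cat duration_cat trace_walk lq1 lerDr.
  by rewrite duration_ge0 // valid_walk.
exists (a :: q); split => //=; first by rewrite ua.
- by rewrite Dq andbT.
- by rewrite unin.
by rewrite lerD2l.
Qed.

(** By [uniq_walk] it suffices to minimise over sequences bounded in size by [#|G|], which form a
    finite type. *)
Lemma exists_shortest_walk D u v p :
  path edge u p -> all (mem D) p -> last u p = v ->
  exists q, shortest_walk D u v q.
Proof.
move=> pp Dp lp.
pose walks q := [&& path edge u q, all (mem D) q & last u q == v].
have short q : walks q -> exists2 q' : (#|G|).-bseq G, walks q' &
    duration u (walk q') <= duration u (walk q).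
  case/and3P=> pq Dq /eqP lq.
  have [q' [pq' Dq' lq' uq' dq']] := uniq_walk pq Dq.
  have sq' : (size q' <= #|G|)%N.
    by apply: leq_trans (max_card (mem (u :: q'))); rewrite (card_uniqP uq').
  by exists (Bseq sq'); rewrite // /walks /= pq' Dq' lq' lq eqxx.
have [|q0 wq0 _] := short p; first by rewrite /walks pp Dp lp eqxx.
case: (@arg_minP _ _ _ q0 (fun q : (#|G|).-bseq G => walks q)
  (fun q : (#|G|).-bseq G => duration u (walk q)) wq0) => q wq qmin.
exists q; split; first by case/and3P: wq => ? ? /eqP.
move=> q' [pq' Dq' lq'].
have [|q'' wq'' dq''] := short q'; first by rewrite /walks pq' Dq' lq' eqxx.
exact: le_trans (qmin _ wq'') dq''.
Qed.

Lemma connected_walk u v : exists p, shortest_walk [set: G] u v p.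
Proof.
have /connectP[p pp ->] := edge_connected u v.
by apply: (exists_shortest_walk pp); rewrite //; apply/allP => x; rewrite /= inE.
Qed.

(** * Distances to [s] and the lower bound on the optimum *)

Section Distance.
Variable s : G.

Definition route u : seq G := sval (cid (connected_walk u s)).
Definition dist u : R := duration u (walk (route u)).
Definition radius : R := \big[Order.max/0]_u dist u.

Lemma routeP u : shortest_walk [set: G] u s (route u).
Proof. exact: (svalP (cid (connected_walk u s))). Qed.

Lemma dist_le u p : path edge u p -> last u p = s ->
  dist u <= duration u (walk p).
Proof.
move=> pp lp; case: (routeP u) => _; apply; split => //.
by apply/allP => x; rewrite /= inE.
Qed.

Lemma shortest_walk_dist u p : shortest_walk [set: G] u s p ->
  duration u (walk p) = dist u.
Proof.
case=> -[pp _ lp] pmin; apply/eqP; rewrite eq_le dist_le // andbT.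
by apply: pmin; case: (routeP u).
Qed.

Lemma dist_ge0 u : 0 <= dist u.
Proof. by apply: duration_ge0; rewrite valid_walk; case: (routeP u) => -[]. Qed.

Lemma dist_root : dist s = 0.
Proof. by apply/eqP; rewrite eq_le dist_ge0 andbT (@dist_le s [::]). Qed.

Lemma dist_edge x y : edge x y -> dist x <= len x y + dist y.
Proof.
move=> xy; case: (routeP y) => -[py _ ly] _.
by apply: (@dist_le x (y :: route y)); rewrite //= xy.
Qed.

Definition parent u : G := head s (route u).

(** Routes of different vertices are chosen independently and need not share their ends. The parents
    still form a shortest-path tree, because only distances enter: the rest of [route u] is a walk
    from [parent u] to [s], and [dist_edge] gives the converse inequality. *)
Lemma parentP u : u != s ->
  edge u (parent u) /\ dist u = len u (parent u) + dist (parent u).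
Proof.
rewrite /parent => us; have dE : dist u = duration u (walk (route u)) by [].
case: (routeP u) => -[]; move: dE; case: (route u) => [|y p] /= dE.
  by move=> _ _ us'; rewrite us' eqxx in us.
move=> /andP[uy py] _ ly _; split=> //; apply/eqP; rewrite eq_le dist_edge //=.
by rewrite dE lerD2l dist_le.
Qed.

Lemma dist_parent u : u != s -> dist (parent u) < dist u.
Proof. by case/parentP => e ->; rewrite ltrDr len_gt0. Qed.

(** Each move changes the distance by at most its length, in either direction; waiting only adds
    time. *)
Lemma dist_duration u a : valid u a ->
  dist u <= duration u a + dist (last u (trace u a)) /\
  dist (last u (trace u a)) <= duration u a + dist u.
Proof.
elim: a u => [|[v|d] a IH] u /=; first by rewrite add0r.
  move=> /andP[uv /IH[h1 h2]].
  have := dist_edge uv; have : edge v u by rewrite edge_sym.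
  move/dist_edge; rewrite (len_sym v u) => *; split; lra.
move=> /andP[d0 /IH[h1 h2]]; split; lra.
Qed.

Lemma dist_radius u : dist u <= radius.
Proof. exact: le_bigmax. Qed.

Lemma radius_ge0 : 0 <= radius.
Proof. exact: le_trans (dist_ge0 s) (dist_radius s). Qed.

Lemma trace_split u a v : v \in trace u a ->
  exists b c, a = b ++ c /\ last u (trace u b) = v.
Proof.
elim: a u => //= -[w|d] a IH u /=; last first.
  by move/IH=> [b [c [-> <-]]]; exists (Wait G d :: b), c.
rewrite inE => /orP[/eqP->|/IH[b [c [-> <-]]]]; first by exists [:: Move w], a.
by exists (Move w :: b), c.
Qed.

(** The agent that visits [v] needs at least [dist v] to get there and as much again to come
    home. *)
Lemma radius_le_cost k (P : plan G k) : explores s P -> 2 * radius <= cost s P.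
Proof.
case=> vP pP visP.
have c0 : 0 <= cost s P by exact: bigmax_ge_id.
rewrite mulrC -ler_pdivlMr //; apply: bigmax_le; first exact: divr_ge0.
move=> v _; rewrite ler_pdivlMr // mulrC.
have : v \in visited s P by rewrite visP inE.
rewrite inE => /orP[/eqP->|/existsP[i vi]]; first by rewrite dist_root mulr0.
apply: le_trans (le_bigmax _ _ i).
have [b [c [E lb]]] := trace_split vi.
have := vP i; have := pP i; rewrite /position E valid_cat trace_cat last_cat lb.
move=> lc /andP[/dist_duration[_]] + /dist_duration[].
rewrite lb lc dist_root duration_cat lb => *; lra.
Qed.

(** [P] itself shows that the set of costs is nonempty, as a lower bound on [inf] requires. *)
Lemma radius_le_opt k (P : plan G k) : explores s P -> 2 * radius <= opt s k.
Proof.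
move=> eP; apply: lb_le_inf; first by exists (cost s P), P.
by move=> _ [Q eQ ->]; exact: radius_le_cost.
Qed.

End Distance.
End Walks.

(** * The weight of a shortest-path tree on a set closed under parents *)

Section ShortestPathTree.
Variables (R : realType) (G : wgraph R) (s : G) (S : {set G}).
Hypothesis sS : s \in S.
Hypothesis parentS : forall v, v \in S -> v != s -> parent s v \in S.

Let children u := #|[set v in S :\ s | parent s v == u]|.

Lemma sum_children : (\sum_(u in S) children u = #|S :\ s|)%N.
Proof.
rewrite -sum1_card [RHS](partition_big (parent s) (mem S)) /=; last first.
  by move=> v /setD1P[vs vS]; apply: parentS.
apply: eq_bigr => u uS; rewrite /children -sum1_card.
by apply: eq_bigl => v; rewrite inE.
Qed.

Lemma children_root : (children s <= #|nbrs s :&: S|)%N.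
Proof.
apply: subset_leq_card; apply/subsetP => v; rewrite !inE.
move=> /andP[/andP[vs vS] /eqP vp]; rewrite vS andbT edge_sym -[X in edge _ X]vp.
by case: (parentP vs).
Qed.

(** The parent of [v] is a neighbour but not a child, because distances strictly decrease towards
    the root. *)
Lemma children_lt v : v \in S -> v != s -> (children v < #|nbrs v :&: S|)%N.
Proof.
move=> vS vs; apply: proper_card; apply/properP; split.
  apply/subsetP => w; rewrite !inE.
  move=> /andP[/andP[ws wS] /eqP <-]; rewrite wS andbT edge_sym.
  by case: (parentP ws).
exists (parent s v); first by rewrite !inE parentS // andbT; case: (parentP vs).
rewrite !inE; apply/negP => /andP[/andP[ps _] /eqP pp].
have := lt_trans (dist_parent ps) (dist_parent vs).
by rewrite pp ltxx.
Qed.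

(* A shortest-path tree has at most [#|nbrs s|] plus the excess degrees many
   leaves, and it is covered by the root paths of its leaves, each of length at
   most the radius. *)
Lemma shortest_path_tree_weight :
  \sum_(v in S :\ s) len v (parent s v) <=
  radius s * (#|nbrs s :&: S| + \sum_(v in S :\ s) (#|nbrs v :&: S| - 2))%:R.
Proof.
(* Each edge length is a difference of distances. Regrouped by parent, a leaf counts its distance
   once and a vertex with [c] children counts it [1 - c] times. *)
have -> : \sum_(v in S :\ s) len v (parent s v) =
    \sum_(v in S :\ s) dist s v * (1 - (children v)%:R).
  transitivity (\sum_(v in S :\ s) (dist s v - dist s (parent s v))).
    by apply: eq_bigr => v /setD1P[/parentP[_ ->] _]; rewrite addrK.
  rewrite sumrB [X in _ - X](partition_big (parent s) (mem S)) /=; last first.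
    by move=> v /setD1P[vs vS]; apply: parentS.
  rewrite [X in _ - X](eq_bigr (fun u => dist s u * (children u)%:R)); last first.
    move=> u uS; rewrite /children mulr_natr -sumr_const.
    by apply: eq_big => [v|v /andP[_ /eqP->]]; rewrite ?inE.
  rewrite [X in _ - X](bigD1 s) //= dist_root mul0r add0r.
  rewrite [X in _ - X](eq_bigl (mem (S :\ s))); last by move=> v; rewrite !inE andbC.
  by rewrite -sumrB; apply: eq_bigr => v _; rewrite mulrBr mulr1.
have M0 := radius_ge0 s.
(* The comparison is termwise. A leaf contributes at most the radius; at an inner vertex the left
   side is at most 0 and the right side is nonnegative by [children_lt]. *)
apply: (@le_trans _ _ (\sum_(v in S :\ s) radius s *
    (1 - (children v)%:R + (#|nbrs v :&: S| - 2)%:R))).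
  apply: ler_sum => v /setD1P[vs vS].
  have d0 := dist_ge0 s v; have dM := dist_radius s v.
  have := children_lt vS vs; case: (children v) => [|c] lt.
    rewrite subr0 mulr1; apply: le_trans dM _.
    by rewrite ler_peMr // lerDl ler0n.
  apply: (@le_trans _ _ 0).
    by rewrite mulr_ge0_le0 // subr_le0 ler1n.
  apply: mulr_ge0 => //; rewrite -natr1.
  have : c%:R <= (#|nbrs v :&: S| - 2)%:R :> R by rewrite ler_nat; lia.
  lra.
rewrite -mulr_sumr; apply: ler_wpM2l => //.
(* The terms [1 - children v] sum to [children s], since [#|S :\ s|] is the total number of
   children. *)
rewrite big_split /= natrD natr_sum lerD2r sumrB.
rewrite sumr_const -sum_children natr_sum (bigD1 s) //=.
rewrite [X in _ + X - _](eq_bigl (mem (S :\ s))); last first.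
  by move=> v; rewrite !inE andbC.
by rewrite addrK ler_nat children_root.
Qed.

End ShortestPathTree.

(** The edge is the first one of the path that enters [V], so the path up to it avoids [V]. *)
Lemma connect_crossing (T : finType) (e : rel T) (V : {set T}) x y :
  connect e x y -> x \notin V -> y \in V ->
  exists a b, [/\ a \notin V, b \in V, e a b &
    connect [rel u w | [&& e u w, u \notin V & w \notin V]] x a].
Proof.
move=> /connectP[p]; elim: p x => [|z p IH] x /= => [_ -> /negP//|].
move=> /andP[xz pz] ly xV yV; have [zV|zV] := boolP (z \in V).
  by exists x, z; rewrite connect0.
have [a [b [aV bV ab ca]]] := IH _ pz ly zV yV.
exists a, b; split => //; apply: connect_trans ca; apply: connect1.
by rewrite /= xz xV.
Qed.

(** * Prim's exchange argument on the shortest-path tree *)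

Section Prim.
Variables (R : realType) (G : wgraph R) (s : G).
Implicit Types (S V Y : {set G}).

(* A set [Y] of vertices stands for the set of edges joining each of them to
   its parent in the shortest-path tree. *)
Definition tree_edge (Y : {set G}) : rel G :=
  [rel x y | ((x \in Y) && (y == parent s x)) || ((y \in Y) && (x == parent s y))].

Definition tree_weight (Y : {set G}) : R := \sum_(v in Y) len v (parent s v).

(** With the visited set [V] contracted to a point, the edges of [Y] connect all of [S] to it. The
    root is kept out of [Y] since it has no parent edge. *)
Definition spans (S V Y : {set G}) : Prop :=
  s \notin Y /\
  forall z, z \in S -> exists2 u, u \in V & connect (tree_edge Y) z u.

Lemma tree_edge_sym Y : symmetric (tree_edge Y).
Proof. by move=> x y; rewrite /tree_edge /= orbC. Qed.

Lemma tree_edgeW Y x y : s \notin Y -> tree_edge Y x y -> edge x y.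
Proof.
move=> sY /orP[] /andP[xY /eqP->]; last rewrite edge_sym.
  by case: (@parentP _ _ s x) => //; apply: contraNneq sY => <-.
by case: (@parentP _ _ s y) => //; apply: contraNneq sY => <-.
Qed.

Lemma tree_weight_ge0 Y : s \notin Y -> 0 <= tree_weight Y.
Proof.
move=> sY; apply: sumr_ge0 => v vY; apply/ltW/len_gt0.
by case: (@parentP _ _ s v) => //; apply: contraNneq sY => <-.
Qed.

(* Prim's exchange: some edge on the way from [v] to [V] in the forest [Y]
   leaves [V], hence is at least as long as the edge just traversed to [v], and
   is superfluous once [v] is visited. *)
Lemma prim_exchange S V Y v l :
  spans S V Y -> v \in S -> v \notin V ->
  (forall a b, a \notin V -> b \in V -> edge a b -> l <= len a b) ->
  exists2 Y', spans S (v |: V) Y' & tree_weight Y' + l <= tree_weight Y.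
Proof.
move=> [sY span] vS vV lmin.
have [u uV /connect_crossing/(_ vV uV)[a [b [aV bV ab va]]]] := span v vS.
have lab := lmin _ _ aV bV (tree_edgeW sY ab).
(* Edges are indexed by their child endpoint, so [y] is whichever of [a] and [b] is the child. *)
have [y [yY yab lY]] : exists y, [/\ y \in Y,
    [\/ y = a /\ parent s y = b | y = b /\ parent s y = a]
    & l <= len y (parent s y)].
  case/orP: ab => /andP[yY /eqP pE]; [exists a|exists b]; split=> //.
  - by left.
  - by rewrite -pE.
  - by right.
  - by rewrite -pE len_sym.
exists (Y :\ y); last first.
  by rewrite /tree_weight [leRHS](big_setD1 y) //= addrC lerD.
(* The path from [v] to [a] stays outside [V], whereas the removed edge ends at [b] in [V]; so the
   path survives. *)
have va' : connect (tree_edge (Y :\ y)) v a.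
  apply: connect_sub va => p q /= /and3P[pq pV qV]; apply: connect1.
  case/orP: pq => /andP[pY /eqP E]; apply/orP; [left|right];
    rewrite !inE pY -E eqxx !andbT; apply/eqP => yE;
    case: yab => -[]; rewrite -?yE -?E => ya yb; subst;
    by rewrite ?bV ?yb ?bV in pV qV *.
split=> [|z zS]; first by rewrite !inE (negPf sY) andbF.
(* Follow the old path from [z]. Where it uses the removed edge it stands at [a], which is still
   connected to the newly visited [v], or at [b], which lies in [V]. *)
have [w wV /connectP[p]] := span z zS.
elim: p z {zS} => [|z' p IH] z /=.
  by move=> _ <-; exists w; rewrite ?inE ?wV ?orbT.
move=> /andP[zz' pz'] /(IH _ pz')[w' w'V cw'].
have [e|e] := boolP (tree_edge (Y :\ y) z z').
  by exists w' => //; apply: connect_trans cw'; apply: connect1.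
have : z = a \/ z = b.
  have : y = z /\ parent s y = z' \/ y = z' /\ parent s y = z.
    case/orP: zz' e => /andP[zY /eqP E]; rewrite /tree_edge /= !inE zY -?E eqxx.
      by rewrite !andbT => /norP[+ _]; rewrite negbK => /eqP <-; left.
    by rewrite !andbT => /norP[_ +]; rewrite negbK => /eqP <-; right.
  by case: yab => -[y1 y2] [] [y3 y4]; [left|right|right|left]; congruence.
case=> ->; last by exists b; rewrite ?inE ?bV ?orbT.
exists v; first by rewrite !inE eqxx.
by rewrite (sym_connect_sym (tree_edge_sym _)).
Qed.

End Prim.

(** Induction along parents is well founded because each step lowers [dist] in a finite graph. *)
Lemma dist_ind (R : realType) (G : wgraph R) (s : G) (P : G -> Prop) :
  (forall v, (v != s -> P (parent s v)) -> P v) -> forall v, P v.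
Proof.
move=> step v.
have [n] := ubnP #|[set u | dist s u < dist s v]|.
elim: n v => // n IH v lt; apply: step => vs; apply: IH.
rewrite ltnS in lt; apply: leq_trans lt.
have pv := dist_parent vs.
apply/proper_card/properP; split; last first.
  by exists (parent s v); rewrite inE // ltxx.
by apply/subsetP => u; rewrite !inE => /lt_trans; apply.
Qed.

(** This is the initial state of Prim's algorithm: following parents inside [S] leads to [s]. *)
Lemma spans_tree (R : realType) (G : wgraph R) (s : G) (S : {set G}) :
  s \in S -> (forall v, v \in S -> v != s -> parent s v \in S) ->
  spans s S [set s] (S :\ s).
Proof.
move=> sS pS; split=> [|z]; first by rewrite !inE eqxx.
elim/(@dist_ind _ _ s): z => z IH zS.
have [->|zs] := eqVneq z s; first by exists s; rewrite ?inE ?connect0.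
have [u us cu] := IH zs (pS _ zS zs); exists u => //.
by apply: connect_trans cu; apply: connect1; rewrite /tree_edge /= !inE zs zS eqxx.
Qed.

(** * Plans, attended edges, and the existence of choices for the strategy *)

Section Plans.
Variables (R : realType) (G : wgraph R) (s : G) (k : nat).
Implicit Types (P : plan G k) (A : {set 'I_k}) (u v x y : G) (p : seq G).
Implicit Types (st : state G k).

Lemma trace_leg P A u p i :
  trace s (leg P A u p i) = trace s (P i) ++ (if i \in A then p else [::]).
Proof. by rewrite /leg trace_cat; case: ifP => _ //; rewrite trace_walk. Qed.

Lemma position_leg P A u p i : position s (leg P A u p) i =
  if i \in A then last (position s P i) p else position s P i.
Proof. by rewrite /position trace_leg last_cat; case: ifP. Qed.

Lemma position_visited P i : position s P i \in visited s P.
Proof.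
have := mem_last s (trace s (P i)); rewrite !inE => /orP[->//|h].
by apply/orP; right; apply/existsP; exists i.
Qed.

Lemma visited_leg P A u p i : i \in A ->
  visited s (leg P A u p) = visited s P :|: [set x in p].
Proof.
move=> iA; apply/setP => x; rewrite !inE -orbA; congr (_ || _).
apply/existsP/orP => [[j]|[/existsP[j xj]|xp]].
- rewrite trace_leg mem_cat => /orP[xj|]; first by left; apply/existsP; exists j.
  by case: ifP => // _ xp; right.
- by exists j; rewrite trace_leg mem_cat xj.
- by exists i; rewrite trace_leg mem_cat iA xp orbT.
Qed.

(** Waiting is recorded explicitly, so all agents have used the same time and [E] is a common clock.
    The walks in the last clause later bound the way of the reserve to [vi]. *)
Definition consistent P (E : R) : Prop :=
  [/\ forall i, valid s (P i), forall i, duration s (P i) = E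
    & forall u, u \in visited s P -> exists p,
        [/\ path edge s p, all (mem (visited s P)) p, last s p = u
          & duration s (walk p) <= E]].

Lemma consistent_leg P E A u p i : consistent P E -> i \in A ->
  (forall j, j \in A -> position s P j = u) -> path edge u p ->
  consistent (leg P A u p) (E + duration u (walk p)).
Proof.
move=> [vP dP wP] iA Au pp.
have d0 : 0 <= duration u (walk p) by rewrite duration_ge0 // valid_walk.
split=> [j|j|x].
- rewrite /leg valid_cat vP /=; case: ifP => [/Au jA|_] /=; last by rewrite d0.
  by rewrite -/(position s P j) jA valid_walk.
- rewrite /leg duration_cat dP; case: ifP => [/Au jA|_] /=; last by rewrite addr0.
  by rewrite -/(position s P j) jA.
have sub : {subset visited s P <= visited s (leg P A u p)}.
  by move=> y yP; rewrite (visited_leg _ _ _ iA) in_setU yP.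
rewrite (visited_leg _ _ _ iA) !in_setU in_set => /orP[xP|xp].
  have [q [pq aq lq dq]] := wP x xP; exists q; split=> //.
    by apply/allP => y /(allP aq) /= /sub; rewrite (visited_leg _ _ _ iA).
  by apply: le_trans dq _; rewrite lerDl.
have := position_visited P i; rewrite (Au _ iA) => uP.
have [q [pq aq lq dq]] := wP u uP.
(* A vertex on [p] is reached by the walk [q] to [u] followed by the part of [p] up to that
   vertex. *)
case/splitPr: xp pp d0 => p1 p2.
rewrite -cat_rcons cat_path => /andP[pp1 pp2] d0.
exists (q ++ rcons p1 x); split.
- by rewrite cat_path pq lq.
- apply/allP => y; rewrite mem_cat => /orP[/(allP aq) yP|yp] /=.
    by apply/setUP; left.
  by apply/setUP; right; rewrite inE mem_cat yp.
- by rewrite last_cat last_rcons.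
rewrite !walk_cat !duration_cat !trace_walk lq last_rcons lerD // lerDl.
by rewrite duration_ge0 // valid_walk; move: pp2; rewrite last_rcons.
Qed.

Definition attended st : Prop :=
  (forall i v, heading st i = Some v -> edge (position s (history st) i) v) /\
  (forall x y, x \in visited s (history st) -> y \notin visited s (history st) ->
     edge x y ->
     exists i, position s (history st) i = x /\ heading st i = Some y).

(** [B] is the set of agents brought to [v]. The spreading attends the edges out of [v]; every other
    edge keeps its agent, because no agent of [B] was heading for a vertex that is still
    unvisited. *)
Lemma attended_spread st st' v (B : {set 'I_k}) :
  attended st ->
  visited s (history st') = v |: visited s (history st) ->
  (forall j, j \in B -> position s (history st') j = v) ->
  (forall j, j \notin B ->
     position s (history st') j = position s (history st) j) ->
  (forall j y, heading st j = Some y -> y \notin v |: visited s (history st) ->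
     j \notin B) ->
  spread B (unexplored s (history st') v) (heading st) (heading st') ->
  attended st'.
Proof.
move=> [at1 at2] visE posB posN hB [hN imB]; split=> [j w|x y].
  have [jB|jB] := boolP (j \in B); last by rewrite hN // posN //; exact: at1.
  move=> jw; have : Some w \in heading st' @: B by rewrite -jw imset_f.
  rewrite imB posB //; case: ifP => _; first by rewrite inE.
  by case/imsetP => w' + [->]; rewrite !inE => /andP[].
rewrite visE => xV yV xy.
have [xv|xv] := eqVneq x v.
  have yD : y \in unexplored s (history st') v.
    by rewrite in_setD visE yV inE -xv.
  have : Some y \in heading st' @: B.
    rewrite imB; case: ifP => [/eqP D0|_]; first by rewrite D0 inE in yD.
    by rewrite imset_f.
  by case/imsetP => j jB jy; exists j; rewrite posB.
have xV' : x \in visited s (history st) by move: xV; rewrite in_setU1 (negPf xv).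
have yV' : y \notin visited s (history st).
  by apply: contra yV; rewrite in_setU1 => ->; rewrite orbT.
have [j [jx jy]] := at2 x y xV' yV' xy.
have jB := hB _ _ jy yV.
by exists j; rewrite posN // hN.
Qed.

(** This is the minimality that [prim_exchange] asks for: an attended edge is among those the ALE
    rule compares. *)
Lemma ale_choice_le st i v a b : attended st -> ale_choice s st i v ->
  a \notin visited s (history st) -> b \in visited s (history st) ->
  edge a b -> len (position s (history st) i) v <= len a b.
Proof.
move=> [_ at2] [_ imin] aV bV ab.
have ba : edge b a by rewrite edge_sym.
have [j [jb ja]] := at2 _ _ bV aV ba.
by rewrite (len_sym a) -jb; apply: imin.
Qed.

(** Connectedness gives an edge out of the visited set, some agent attends it, and a shortest
    candidate is taken among the finitely many agents. *)
Lemma exists_ale_choice st : attended st ->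
  visited s (history st) != [set: G] -> exists i v, ale_choice s st i v.
Proof.
move=> [at1 at2] /eqP VT.
have [z zV] : exists z, z \notin visited s (history st).
  apply/not_existsP => h; apply: VT; apply/setP => z; rewrite in_setT.
  by apply/negPn/negP; exact: h.
have sV : s \in visited s (history st) by rewrite !inE eqxx.
have [a [b [aV bV ab _]]] := connect_crossing (edge_connected z s) zV sV.
have ba : edge b a by rewrite edge_sym.
have [j [jb ja]] := at2 _ _ bV aV ba.
pose cand i := if heading st i is Some v
  then v \notin visited s (history st) else false.
pose cost i := if heading st i is Some v
  then len (position s (history st) i) v else 0.
have cj : cand j by rewrite /cand ja.
case: (@arg_minP _ _ _ j cand cost cj) => i.
rewrite /cand; case iv: (heading st i) => [v|//] vV imin.
exists i, v; split=> // j' w [j'w wV].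
have := imin j'; rewrite /cost iv j'w; exact.
Qed.

(** The agents of [A], in the order of enumeration, take the directions in turn. Surplus agents
    follow [d], the default of [nth], so no heading outside [D] arises. *)
Lemma exists_spread (A : {set 'I_k}) (D : {set G}) h : A != set0 ->
  (#|D| <= #|A|)%N -> exists h', spread A D h h'.
Proof.
move=> /set0Pn[a aA] DA; have [D0|/set0Pn[d dD]] := eqVneq D set0.
  exists (fun j => if j \in A then None else h j); split.
    by move=> j /negPf->.
  apply/setP => o; rewrite D0 eqxx inE; apply/imsetP/eqP => [[j ->]//|->].
  by exists a; rewrite ?aA.
exists (fun j => if j \in A then Some (nth d (enum D) (index j (enum A))) else h j).
split=> [j /negPf->//|].
have -> : (D == set0) = false by apply/negbTE/set0Pn; exists d.
apply/setP => o; apply/imsetP/imsetP => [[j jA ->]|[y yD ->]].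
  exists (nth d (enum D) (index j (enum A))); last by rewrite jA.
  have [lt|ge] := ltnP (index j (enum A)) (size (enum D)).
    by rewrite -mem_enum mem_nth.
  by rewrite nth_default.
have lt : (index y (enum D) < #|A|)%N.
  by apply: leq_trans DA; rewrite cardE index_mem mem_enum.
have jA : nth a (enum A) (index y (enum D)) \in A.
  by rewrite -mem_enum mem_nth -?cardE.
exists (nth a (enum A) (index y (enum D))) => //.
by rewrite jA index_uniq ?enum_uniq -?cardE // nth_index // mem_enum.
Qed.

Lemma exists_initial : (deg s <= 3)%N -> (3 <= k)%N -> exists st : state G k, initial s st.
Proof.
move=> deg3 k3; pose L := flatten [seq nseq (crew s k) (Some v) | v <- enum (nbrs s)].
have countL v : edge s v -> count_mem (Some v) L = crew s k.
  move=> sv; rewrite count_flatten -map_comp sumnE big_map big_enum /=.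
  rewrite (bigD1 v) ?inE //= count_nseq /= eqxx mul1n big1 ?addn0 // => w.
  by case/andP => _ wv; rewrite count_nseq /= (inj_eq Some_inj) (negPf wv).
have sizeL : (size L <= k)%N.
  rewrite size_flatten /shape -map_comp sumnE big_map big_enum /=.
  under eq_bigr do rewrite size_nseq.
  rewrite sum_nat_const -/(deg s) /crew.
  (* For degrees 1, 2 and 3 the agents needed are [2], [2 * k./2] and [3], each at most [k]. *)
  have := leq_trunc_div k 2; rewrite divn2.
  by case: (deg s) deg3 => [|[|[|[|d]]]] //=; lia.
exists (State (fun=> [::]) (fun i => nth None L i)); split=> //= [i v|v sv].
  have [lt|ge] := ltnP i (size L); last by rewrite nth_default.
  move=> iv; have : Some v \in L by rewrite -iv mem_nth.
  by case/flatten_mapP => w; rewrite mem_enum inE mem_nseq => sw /andP[_ /eqP[->]].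
rewrite -(countL v sv) -sum1_count (big_nth None) big_mkord -sum1_card.
rewrite (big_ord_widen_cond _ (fun i => nth None L i == Some v) (fun=> 1%N) sizeL).
apply: eq_bigl => i; rewrite inE andbC.
have [//|ge] := ltnP i (size L); by rewrite nth_default.
Qed.

(** Two crews of [k./2] agents leave the parity of [k]: one waiting agent out of three, none out of
    four. *)
Lemma card_reserve (st0 : state G k) : initial s st0 -> deg s = 2%N ->
  #|[set i | heading st0 i == None]| = odd k.
Proof.
move=> [_ hE hC] dE.
have : (k = #|[set i | heading st0 i == None]| + 2 * k./2)%N.
  rewrite -[LHS]card_ord -[LHS]sum1_card [LHS](bigID (fun i => heading st0 i == None)) /=.
  congr (_ + _)%N; first by rewrite -sum1_card; apply: eq_bigl => i; rewrite inE.
  rewrite -{1}dE -sum_nat_const.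
  rewrite (partition_big (fun i => odflt s (heading st0 i)) (mem (nbrs s))) /=.
    apply: eq_bigr => w; rewrite inE => sw.
    have := hC w sw; rewrite /crew dE => <-; rewrite -sum1_card.
    by apply: eq_bigl => j; rewrite inE; case: (heading st0 j).
  move=> j; rewrite inE; case jw: (heading st0 j) => [w|//] _; exact: hE jw.
by rewrite mul2n -{1}(odd_double_half k) => /addIn ->.
Qed.

End Plans.

(** * Analysis of the strategy by an invariant on its states *)

Section Strategy.
Variables (R : realType) (G : wgraph R) (s : G) (k : nat).
Variables (vi : G) (X : {set G}).
Hypothesis deg_vi : deg vi = 3%N.
Hypothesis deg_le2 : forall v, v != vi -> (deg v <= 2)%N.
(* [vi] is a cut vertex, with [X] on the side away from [s]. *)
Hypothesis sX : s \notin X.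
Hypothesis viX : vi \notin X.
Hypothesis X_exit : forall x y, x \in X -> y \notin X -> edge x y -> y = vi.
Hypothesis vi_exit : (#|nbrs vi :\: X| <= 2)%N.
Implicit Types (st : state G k) (Z : {set 'I_k}).

Let M := radius s.

Lemma deg3P v : (deg v == 3)%N = (v == vi).
Proof.
apply/eqP/eqP => [v3|->//]; apply/eqP; apply: contraT => /deg_le2.
by rewrite v3.
Qed.

(** The chain of parents from [x] to [s] must leave [X], and it can do so only into [vi]. *)
Lemma dist_side x : x \in X -> dist s vi < dist s x.
Proof.
elim/(@dist_ind _ _ s): x => x IH xX.
have xs : x != s by apply: contraNneq sX => <-.
apply: le_lt_trans (dist_parent xs).
have [pX|pX] := boolP (parent s x \in X); first exact/ltW/IH.
by case: (parentP xs) => /(X_exit xX pX) ->.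
Qed.

(** A parent inside [X] could only be that of [vi], but [X] is farther from [s] than [vi]. The
    shortest-path tree thus restricts to the side of [s]. *)
Lemma parent_side v : v \in ~: X -> v != s -> parent s v \in ~: X.
Proof.
rewrite !inE => vX vs; apply/negP => pX.
have pv : edge (parent s v) v by rewrite edge_sym; case: (parentP vs).
have vE := X_exit pX vX pv.
have := lt_trans (dist_side pX) (dist_parent vs).
by rewrite vE ltxx.
Qed.

(** The leaf count is at most 3: it is [deg vi] if [s] is [vi], and otherwise at most 2 for [s] plus
    1 for the excess degree of [vi]. *)
Lemma tree_weight_full : tree_weight s ([set: G] :\ s) <= 3 * M.
Proof.
apply: le_trans (shortest_path_tree_weight (in_setT s) _) _.
  by move=> v _ _; rewrite inE.
rewrite mulrC ler_wpM2r ?radius_ge0 // ler_nat setIT.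
under eq_bigr do rewrite setIT.
have [svi|svi] := eqVneq s vi.
  rewrite svi -/(deg vi) deg_vi big1 // => v /setD1P[/deg_le2 + _].
  by rewrite -subn_eq0 => /eqP.
rewrite (bigD1 vi) /=; last by rewrite !inE eq_sym svi.
rewrite big1 => [|v /andP[_ /deg_le2]]; last by rewrite -subn_eq0 => /eqP.
by rewrite -/(deg s) -/(deg vi) deg_vi addn0 subSS subn1 addn1 ltnS deg_le2.
Qed.

(** Within [~: X] no vertex has excess degree, not even [vi], so only the at most two neighbours of
    [s] count. *)
Lemma tree_weight_side : s != vi -> tree_weight s (~: X :\ s) <= 2 * M.
Proof.
move=> svi; apply: le_trans (shortest_path_tree_weight _ parent_side) _.
  by rewrite inE.
rewrite mulrC ler_wpM2r ?radius_ge0 // ler_nat.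
have le v : (#|nbrs v :&: ~: X| <= 2)%N.
  have [->|/deg_le2] := eqVneq v vi; first by rewrite -setDE.
  by apply: leq_trans; apply: subset_leq_card; exact: subsetIl.
by rewrite big1 ?addn0 // => v _; apply/eqP; rewrite subn_eq0.
Qed.

(* The term [2 * M] in [inv_tree] pays for the walk of the reserve [Z] to [vi]. *)
Record invariant Z st (E : R) : Prop := Invariant {
  inv_consistent : consistent s (history st) E;
  inv_attended : attended s st;
  inv_tree : exists2 Y, spans s [set: G] (visited s (history st)) Y &
    E + tree_weight s Y <=
    3 * M + (if (vi \in visited s (history st)) && (Z != set0) then 2 * M else 0);
  inv_waiting : vi \notin visited s (history st) -> forall j, j \in Z ->
    heading st j = None /\ position s (history st) j = s;
  inv_team : vi \notin visited s (history st) -> Z = set0 ->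
    forall i v, heading st i = Some v -> (2 <= #|team s st i|)%N;
  inv_side : vi \notin visited s (history st) ->
    [disjoint visited s (history st) & X] /\
    exists2 Y, spans s (~: X) (visited s (history st)) Y &
      E + tree_weight s Y <= 2 * M }.

Lemma invariant_initial st : (3 <= k)%N -> initial s st ->
  invariant (reserve s st) st 0.
Proof.
move=> k3 init; have [h0 hE hC] := init.
have pos0 i : position s (history st) i = s by rewrite /position h0.
have vis0 : visited s (history st) = [set s].
  apply/setP => x; rewrite !inE; apply/orP/idP => [[//|/existsP[i]]|]; last by left.
  by rewrite h0.
split; rewrite ?vis0.
- split=> [i|i|u]; rewrite ?h0 // vis0 inE => /eqP->.
  by exists [::].
- split=> [i v|x y]; first by rewrite pos0; exact: hE.
  rewrite vis0 inE => /eqP-> _ sy.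
  have : (0 < crew s k)%N.
    by rewrite /crew; case: (deg s) => [|[|[|?]]] //; rewrite half_gt0 ltnW.
  rewrite -(hC y sy) card_gt0 => /set0Pn[i]; rewrite inE => /eqP iy.
  by exists i.
- exists ([set: G] :\ s).
    by apply: spans_tree; rewrite ?inE // => v *; rewrite inE.
  rewrite add0r; apply: le_trans tree_weight_full _; rewrite lerDl.
  by case: ifP => // _; rewrite mulr_ge0 // radius_ge0.
- move=> _ j; rewrite pos0 /reserve; case: ifP => _; last by rewrite inE.
  by rewrite inE => /eqP.
- rewrite inE eq_sym => svi Z0 i v iv; have := hE _ _ iv => sv.
  have -> : team s st i = [set j | heading st j == Some v].
    by apply/setP => j; rewrite !inE !pos0 eqxx iv.
  rewrite hC //; have := deg_le2 svi; have : (0 < deg s)%N.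
    by apply/card_gt0P; exists v; rewrite inE.
  rewrite /crew; move: Z0; rewrite /reserve.
  (* Only degree 2 needs an argument: an empty reserve makes [k] even, and then [3 <= k] gives crews
     of at least two. *)
  case dE: (deg s) => [|[|[|d]]] //= Z0 _ _.
  have := card_reserve init dE; have := odd_double_half k.
  by rewrite Z0 cards0; case: (odd k) => // + _; lia.
- rewrite inE eq_sym => svi; split.
    by apply/pred0P => x /=; rewrite inE; apply/andP => -[/eqP->]; rewrite (negPf sX).
  exists (~: X :\ s); last by rewrite add0r tree_weight_side.
  by apply: spans_tree parent_side; rewrite inE.
Qed.

Lemma consistent_traverse Z st E i v : invariant Z st E -> ale_choice s st i v ->
  consistent s (leg (history st) (team s st i) (position s (history st) i) [:: v])
    (E + len (position s (history st) i) v).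
Proof.
move=> [cons [at1 _] _ _ _ _] [[iv _] _].
have := @consistent_leg _ _ _ _ _ _ (team s st i)
  (position s (history st) i) [:: v] i cons.
rewrite /= addr0; apply.
- by rewrite inE !eqxx.
- by move=> j; rewrite inE => /andP[/eqP].
- by rewrite /= andbT at1.
Qed.

Lemma visited_traverse st i v :
  visited s (leg (history st) (team s st i) (position s (history st) i) [:: v]) =
  v |: visited s (history st).
Proof.
rewrite (@visited_leg _ _ _ _ _ _ _ _ i); last by rewrite inE !eqxx.
by rewrite setUC; congr (_ :|: _); apply/setP => x; rewrite !inE.
Qed.

(** Time grows by the length of the traversed edge while [prim_exchange] frees at least that much
    weight, so the sum never grows. *)
Lemma tree_traverse Z st E i v b (S : {set G}) : invariant Z st E ->
  ale_choice s st i v -> v \in S ->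
  (exists2 Y, spans s S (visited s (history st)) Y & E + tree_weight s Y <= b) ->
  exists2 Y, spans s S (v |: visited s (history st)) Y &
    E + len (position s (history st) i) v + tree_weight s Y <= b.
Proof.
move=> inv ch vS [Y sp le].
have [[iv vV] _] := ch.
have [Y' sp' le'] := prim_exchange sp vS vV
  (fun a b => @ale_choice_le _ _ _ _ _ _ _ a b (inv_attended inv) ch).
exists Y' => //; lra.
Qed.

(** From outside, [X] can be entered only through [vi]. *)
Lemma side_traverse Z st E i v : invariant Z st E -> ale_choice s st i v ->
  vi \notin visited s (history st) -> v \notin X.
Proof.
move=> inv [[iv vV] _] viV; apply/negP => vX.
have [dis _] := inv_side inv viV.
have [at1 _] := inv_attended inv; have := at1 _ _ iv.
rewrite edge_sym => /(X_exit vX).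
have pV := position_visited s (history st) i.
by rewrite (disjointFr dis pV) => /(_ isT) pE; rewrite pE (negPf viV) in pV.
Qed.

Lemma invariant_step Z st st' E : invariant Z st E -> ale_step s Z st st' ->
  exists E', invariant Z st' E'.
Proof.
move=> inv step.
have M0 : 0 <= 2 * M by rewrite mulr_ge0 // radius_ge0.
case: step => [i v ch nJ hE spr|i v p ch /andP[v3 Z0] [sw hE] spr].
  have [[iv vV] _] := ch.
  have visE : visited s (history st') = v |: visited s (history st).
    by rewrite hE visited_traverse.
  have posB j : j \in team s st i -> position s (history st') j = v.
    by move=> ji; rewrite hE position_leg ji.
  have posN j : j \notin team s st i ->
      position s (history st') j = position s (history st) j.
    by move=> /negPf ji; rewrite hE position_leg ji.
  have new : vi \notin v |: visited s (history st) ->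
      v != vi /\ vi \notin visited s (history st).
    by rewrite !in_setU1 negb_or eq_sym => /andP.
  exists (E + len (position s (history st) i) v); split.
  - by rewrite hE; exact: consistent_traverse inv ch.
  - apply: (attended_spread (inv_attended inv) visE posB posN _ spr) => j y jy.
    apply: contra; rewrite inE => /andP[_]; rewrite jy iv => /eqP[->].
    by rewrite in_setU1 eqxx.
  - rewrite visE; have [Y sp le] := tree_traverse inv ch (in_setT v) (inv_tree inv).
    exists Y => //; apply: le_trans le _; rewrite lerD2l in_setU1.
    by case: (vi \in _); rewrite ?orbT //=; case: ifP.
  - rewrite visE => /new[_ viV] j jZ.
    have [jN js] := inv_waiting inv viV jZ.
    have jB : j \notin team s st i by rewrite inE jN iv andbF.
    by rewrite posN //; case: spr => -> //.
  - rewrite visE => /new[vvi viV] Z0 j w jw.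
    case: spr => hN imB; have [jB|jB] := boolP (j \in team s st i).
      apply: leq_trans (inv_team inv viV Z0 iv) _.
      apply/subset_leq_card/subsetP => j' j'B.
      rewrite inE !posB // eqxx /=.
      (* Away from [vi] at most one direction is left, since the edge of arrival leads back to a
         visited vertex; so the team stays together. *)
      have D1 : (#|unexplored s (history st') v| <= 1)%N.
        rewrite -ltnS; apply: leq_trans (deg_le2 vvi).
        apply/proper_card/properP; split; first exact: subsetDl.
        have [at1 _] := inv_attended inv.
        exists (position s (history st) i).
          by rewrite inE edge_sym; exact: at1.
        by rewrite in_setD visE in_setU1 position_visited orbT.
      have : heading st' j \in heading st' @: team s st i by rewrite imset_f.
      have : heading st' j' \in heading st' @: team s st i by rewrite imset_f.
      rewrite imB jw; case: ifP => _; first by rewrite !inE => _ /eqP.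
      case/imsetP => w1 w1D -> /imsetP[w2 w2D ->].
      by rewrite (card_le1_eqP D1 _ _ w1D w2D).
    (* A team that did not move loses no member. *)
    rewrite hN // in jw; apply: leq_trans (inv_team inv viV Z0 jw) _.
    apply/subset_leq_card/subsetP => j'; rewrite !inE => /andP[/eqP j'p /eqP j'h].
    have j'B : j' \notin team s st i by apply: contra jB; rewrite !inE j'p j'h.
    by rewrite !posN // j'p eqxx !hN // j'h eqxx.
  - rewrite visE => /new[vvi viV].
    have vX := side_traverse inv ch viV.
    have [dis tr] := inv_side inv viV; split.
      apply/pred0P => x /=; rewrite in_setU1.
      have [->|_] := eqVneq x v; first by rewrite (negPf vX) andbF.
      exact: (pred0P dis).
    by apply: tree_traverse inv ch _ tr; rewrite inE.
(* In the remaining case [vi] has just been found and the reserve joins. *)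
have {v3} vE : v = vi by apply/eqP; rewrite -deg3P.
have [[iv vV] _] := ch.
have viV : vi \notin visited s (history st) by rewrite -vE.
set P := leg _ _ _ [:: v] in sw hE.
have consP : consistent s P (E + len (position s (history st) i) v).
  exact: consistent_traverse inv ch.
have visP : visited s P = v |: visited s (history st) by exact: visited_traverse.
have waitP j : j \in Z -> [/\ j \notin team s st i, heading st j = None
    & position s P j = s].
  move=> /(inv_waiting inv viV)[jN js]; have jB : j \notin team s st i.
    by rewrite inE jN iv andbF.
  by rewrite /P position_leg (negPf jB).
have /set0Pn[z zZ] := Z0.
have [[pp ap lp] pmin] := sw.
have visE : visited s (history st') = v |: visited s (history st).
  rewrite hE (visited_leg _ _ _ _ zZ) -visP; apply/setUidPl/subsetP => x.
  by rewrite in_set => /(allP ap).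
have posZ j : j \in Z -> position s (history st') j = v.
  by move=> jZ; rewrite hE position_leg jZ; case: (waitP j jZ) => _ _ ->.
have posN j : j \notin Z -> position s (history st') j = position s P j.
  by move=> jZ; rewrite hE position_leg (negPf jZ).
(* The reserve's shortest walk takes no longer than the time elapsed so far, which Prim's algorithm
   on the side of [s] bounds by [2 * M]. *)
have pE : duration s (walk p) <= 2 * M.
  have [_ _ wP] := consP.
  have [|q [pq aq lq dq]] := wP v; first by rewrite visP setU11.
  apply: le_trans (pmin q _) _ => //; apply: le_trans dq _.
  have [Y sp le] : exists2 Y, spans s (~: X) (v |: visited s (history st)) Y &
      E + len (position s (history st) i) v + tree_weight s Y <= 2 * M.
    have [_ tr] := inv_side inv viV.
    by apply: tree_traverse inv ch _ tr; rewrite vE inE.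
  by apply: le_trans le; rewrite lerDl tree_weight_ge0 //; case: sp.
exists (E + len (position s (history st) i) v + duration s (walk p)).
have viV' : vi \in visited s (history st') by rewrite visE vE setU11.
split; rewrite ?viV' //.
- rewrite hE; apply: (consistent_leg consP zZ) => // j /waitP[_ _ //].
- apply: (attended_spread (inv_attended inv) visE _ _ _ spr) => [j|j|j y jy].
  + have [jZ _|jZ] := boolP (j \in Z); first exact: posZ.
    by rewrite in_setU (negPf jZ) orbF posN // /P position_leg => ->.
  + rewrite in_setU negb_or => /andP[jB jZ].
    by rewrite posN // /P position_leg (negPf jB).
  rewrite in_setU1 negb_or in_setU => /andP[yv _]; apply/norP; split.
    by apply: contra yv; rewrite inE jy iv => /andP[_ /eqP[->]].
  by apply/negP => /waitP[_]; rewrite jy.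
have [Y sp le] := tree_traverse inv ch (in_setT v) (inv_tree inv).
exists Y; first by rewrite visE.
(* The allowance of [2 * M] becomes available at this very step and pays for [pE]. *)
move: le; rewrite (negPf viV) Z0 /=; lra.
Qed.

(** What may fail is the supply of agents, as [vi] can leave two directions open. Without a reserve
    [inv_team] provides two agents; otherwise one explorer and one waiting agent suffice. *)
Lemma exists_ale_step st st0 E : invariant (reserve s st0) st E ->
  visited s (history st) != [set: G] ->
  exists st', ale_step s (reserve s st0) st st'.
Proof.
set Z := reserve s st0 => inv VT.
have [i [v ch]] := exists_ale_choice (inv_attended inv) VT.
have [[iv vV] _] := ch.
have [at1 _] := inv_attended inv.
pose P := leg (history st) (team s st i) (position s (history st) i) [:: v].
have visP : visited s P = v |: visited s (history st) by exact: visited_traverse.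
have unexp (Q : plan G k) : visited s Q = visited s P ->
    (#|unexplored s Q v| <= if v == vi then 2 else 1)%N.
  move=> visQ; rewrite -ltnS.
  apply: (@leq_trans (deg v)).
    apply/proper_card/properP; split; first exact: subsetDl.
    exists (position s (history st) i); first by rewrite inE edge_sym at1.
    by rewrite in_setD visQ visP in_setU1 position_visited orbT.
  by case: eqVneq => [->|/deg_le2//]; rewrite deg_vi.
have iT : i \in team s st i by rewrite inE !eqxx.
have [|J] := boolP ((deg v == 3)%N && (Z != set0)); last first.
  have [||h' sp] := @exists_spread _ G k (team s st i) (unexplored s P v) (heading st).
  - by apply/set0Pn; exists i.
  - apply: leq_trans (unexp P _) _ => //; case: eqVneq => [vE|_].
      rewrite deg3P vE eqxx /= negbK in J; rewrite vE in vV.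
      exact: inv_team inv vV (eqP J) _ _ iv.
    by apply/card_gt0P; exists i.
  by exists (State P h'); apply: (AleTraverse ch J).
move=> J; have /andP[] := J; rewrite deg3P => /eqP vE /set0Pn[z zZ].
have viV : vi \notin visited s (history st) by rewrite -vE.
have [_ _ wP] := consistent_traverse inv ch.
have [|q [pq aq lq _]] := wP v; first by rewrite visP setU11.
have [p sw] := exists_shortest_walk pq aq lq.
have visQ : visited s (leg P Z s p) = visited s P.
  rewrite (visited_leg _ _ _ _ zZ); apply/setUidPl/subsetP => x.
  by case: sw => -[_ ap _] _; rewrite in_set => /(allP ap).
have zT : z \notin team s st i.
  by have [zN _] := inv_waiting inv viV zZ; rewrite inE zN iv andbF.
have [||h' sp] := @exists_spread _ G k (team s st i :|: Z)
    (unexplored s (leg P Z s p) v) (heading st).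
- by apply/set0Pn; exists i; rewrite inE iT.
- apply: leq_trans (unexp _ visQ) _; rewrite vE eqxx.
  apply: leq_trans (_ : #|[set i; z]| <= _)%N.
    by rewrite cards2; case: eqVneq => // iz; rewrite -iz iT in zT.
  apply/subset_leq_card/subsetP => j; rewrite in_set2 in_setU.
  by case/orP => /eqP->; rewrite ?iT ?zZ ?orbT.
exists (State (leg P Z s p) h').
by apply: (AleTraverseJoin (p := p) ch J).
Qed.

Lemma invariant_reach st0 st : (3 <= k)%N -> initial s st0 ->
  ale_reach s st0 st -> exists E, invariant (reserve s st0) st E.
Proof.
move=> k3 init; elim=> [|st1 st2 _ [E inv]]; last exact: invariant_step inv.
by exists 0; exact: invariant_initial.
Qed.

Lemma visited_step Z st st' : ale_step s Z st st' ->
  visited s (history st) \proper visited s (history st').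
Proof.
have sub (P : plan G k) (A : {set 'I_k}) u p i : i \in A ->
    visited s P \subset visited s (leg P A u p).
  by move=> iA; rewrite (visited_leg _ _ _ _ iA) subsetUl.
have tr i v : ale_choice s st i v -> visited s (history st) \proper
    visited s (leg (history st) (team s st i) (position s (history st) i) [:: v]).
  by move=> [[_ vV] _]; rewrite visited_traverse properUr // sub1set.
case=> [i v /tr pr _ -> _ //|i v p /tr pr /andP[_ /set0Pn[z zZ]] [_ ->] _].
by apply: proper_sub_trans pr _; exact: sub zZ.
Qed.

(** Every step visits a new vertex and no run gets stuck early, so the number of unvisited vertices
    serves as induction measure. *)
Lemma exists_ale_run st0 : (3 <= k)%N -> initial s st0 ->
  exists2 st, ale_reach s st0 st & visited s (history st) = [set: G].
Proof.
move=> k3 init.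
suff run n st : (#|~: visited s (history st)| < n)%N -> ale_reach s st0 st ->
    exists2 st', ale_reach s st0 st' & visited s (history st') = [set: G].
  by apply: (run _ st0 (ltnSn _)); exact: AleStart.
elim: n st => // n IH st lt re.
have [VT|VT] := eqVneq (visited s (history st)) [set: G]; first by exists st.
have [E inv] := invariant_reach k3 init re.
have [st' step] := exists_ale_step inv VT.
apply: (IH st'); last exact: AleNext re step.
rewrite ltnS in lt; apply: leq_trans lt; apply: proper_card.
by rewrite properC; exact: visited_step step.
Qed.

Lemma ale_explores (P : plan G k) : (3 <= k)%N -> ale s P -> explores s P /\
  cost s P <= 2 * M * (if odd k then 3 else 2).
Proof.
move=> k3 [st0 [st [init re ends fin]]].
have [E inv] := invariant_reach k3 init re.
have VT : visited s (history st) = [set: G].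
  case: ends => // stuck; apply/eqP; apply: contraT => /(exists_ale_step inv).
  by move/stuck.
have [vH dH _] := inv_consistent inv.
have M0 : 0 <= M by exact: radius_ge0.
(* Since everything is visited, the walk home is shortest in the whole graph and takes at most
   [M]. *)
have PE i : exists p, [/\ path edge (position s (history st) i) p,
    last (position s (history st) i) p = s, P i = history st i ++ walk p &
    duration (position s (history st) i) (walk p) <= M].
  have [p sw ->] := fin i; rewrite VT in sw; exists p; split => //.
  - by case: sw => -[].
  - by case: sw => -[].
  by rewrite (shortest_walk_dist sw) dist_radius.
split.
  split=> [i|i|].
  - have [p [pp _ -> _]] := PE i.
    by rewrite valid_cat vH -/(position s _ i) valid_walk.
  - have [p [_ lp E' _]] := PE i.
    by rewrite /position E' trace_cat last_cat -/(position s _ i) trace_walk.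
  apply/setP => x; rewrite in_setT.
  have : x \in visited s (history st) by rewrite VT inE.
  rewrite !inE => /orP[->//|/existsP[i xi]]; apply/orP; right; apply/existsP.
  have [p [_ _ E' _]] := PE i; exists i.
  by rewrite E' trace_cat mem_cat xi.
(* [inv_tree] gives [E <= 3 * M], or [E <= 5 * M] with a reserve, which by [card_reserve] occurs
   only for odd [k]. The added [M] is the way home. *)
have E_le : E + M <= 2 * M * (if odd k then 3 else 2).
  have [Y [sY _] le] := inv_tree inv; have := tree_weight_ge0 sY.
  move: le; rewrite VT in_setT /=; have [H|_] := ifP; last first.
    by case: ifP => _; lra.
  have -> : odd k; last by lra.
  move: H; rewrite /reserve; case: ifP => [/eqP dE|_]; last by rewrite eqxx.
  by rewrite -card_gt0 (card_reserve init dE) lt0b.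
apply: bigmax_le => [|i _]; first by case: ifP => _; lra.
have [p [_ _ -> dp]] := PE i; apply: le_trans E_le.
by rewrite duration_cat dH lerD2l.
Qed.

End Strategy.

(** * Degrees and the cut vertex of a tadpole *)

Section Tadpoles.
Variables (R : realType) (G : wgraph R).
Implicit Types (a b p : seq G) (x y : G).

Lemma mem_zip a b x y : (x, y) \in zip a b -> x \in a /\ y \in b.
Proof.
elim: a b => [|a0 a IH] [|b0 b] //=; rewrite !inE => /orP[/eqP[-> ->]|/IH[-> ->]].
  by rewrite !eqxx.
by rewrite !orbT.
Qed.

Lemma mem_zip_last x p y : (last x p, y) \in zip (x :: p) (rcons p y).
Proof. by elim: p x => [|z p IH] x; rewrite /= inE ?eqxx // -/(zip _ _) IH orbT. Qed.

Lemma zip_functional a b x y y' : uniq a ->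
  (x, y) \in zip a b -> (x, y') \in zip a b -> y = y'.
Proof.
elim: a b => [|a0 a IH] [|b0 b] //= /andP[a0a ua]; rewrite !inE.
case/orP=> [/eqP[-> ->]|xy]; case/orP => [/eqP[]//|xy'].
- by have [] := mem_zip xy'; rewrite (negPf a0a).
- by move=> xa; have [] := mem_zip xy; rewrite xa (negPf a0a).
exact: IH xy xy'.
Qed.

Lemma zip_sym a b x y : ((x, y) \in zip a b) = ((y, x) \in zip b a).
Proof.
by elim: a b => [|a0 a IH] [|b0 b] //=; rewrite !inE IH !xpair_eqE andbC.
Qed.

Lemma card_zip a b x : uniq a -> (#|[set y | (x, y) \in zip a b]| <= (x \in a))%N.
Proof.
move=> ua; have [xa|xa] := boolP (x \in a).
  by apply/card_le1_eqP => y y'; rewrite !inE => h h'; exact: zip_functional ua h' h.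
rewrite leqn0 cards_eq0; apply/eqP/setP => y; rewrite !inE.
by apply/negP => /mem_zip[]; rewrite (negPf xa).
Qed.

(** Read in either direction the zip is a partial function, as both lists are free of duplicates:
    [x] has at most one successor and at most one predecessor. *)
Lemma card_joined a b x : uniq a -> uniq b ->
  (#|[set y | joined (zip a b) x y]| <= (x \in a) + (x \in b))%N.
Proof.
move=> ua ub.
have -> : [set y | joined (zip a b) x y] =
    [set y | (x, y) \in zip a b] :|: [set y | (x, y) \in zip b a].
  by apply/setP => y; rewrite !inE /joined (zip_sym a b y).
by apply: leq_trans (leq_card_setU _ _) _; rewrite leq_add ?card_zip.
Qed.

(** These are the properties of a tadpole that the analysis of the strategy uses. [X] is the cycle
    without [vi] if [s] lies on the tail, and the tail otherwise; either contains a neighbour of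
    [vi], which leaves at most two outside. *)
Lemma tadpole_cut : tadpole G -> exists vi : G, [/\ deg vi = 3%N,
  forall v, v != vi -> (deg v <= 2)%N
  & forall s, exists X : {set G}, [/\ s \notin X, vi \notin X,
      forall x y, x \in X -> y \notin X -> edge x y -> y = vi
    & (#|nbrs vi :\: X| <= 2)%N]].
Proof.
case=> vi [c [t [U c2 t1 cover edgeE]]].
have [vic vit] : vi \notin c /\ vi \notin t.
  by move: U => /= /andP[]; rewrite mem_cat negb_or => /andP.
have [uc ut] : uniq c /\ uniq t.
  by move: U => /= /andP[_]; rewrite cat_uniq => /and3P[].
have dis x : x \in c -> x \notin t.
  move=> xc; apply/negP => xt; move: U => /= /andP[_].
  by rewrite cat_uniq => /and3P[_ /hasP[]]; exists x.
(* A vertex has at most two neighbours along the cycle and two along the tail, but [vi] has only one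
   along the tail, being absent from the second list of that zip. *)
have deg_le v : (deg v <= ((v == vi) + (v \in c)).*2 + ((v == vi) + (v \in t).*2))%N.
  have -> : deg v = #|[set y | joined (zip (vi :: c) (rcons c vi)) v y]
                   :|: [set y | joined (zip (vi :: t) t) v y]|.
    by apply: eq_card => y; rewrite !inE edgeE.
  apply: leq_trans (leq_card_setU _ _) _; apply: leq_add.
    apply: leq_trans (card_joined _ _ _) _; rewrite ?rcons_uniq /= ?vic //.
    rewrite mem_rcons inE; case: eqVneq => [->|_]; by case: (_ \in c).
  apply: leq_trans (card_joined _ _ _) _; rewrite /= ?vit //.
  by rewrite inE; case: eqVneq => [->|_]; rewrite ?(negPf vit) // addnn.
have E1 y : (vi, y) \in zip (vi :: c) (rcons c vi) -> edge vi y.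
  by rewrite edgeE /joined => ->.
have [c0 [c1 [c0c c1c c01 ec0 ec1]]] : exists c0 c1,
    [/\ c0 \in c, c1 \in c, c0 != c1, edge vi c0 & edge vi c1].
  case: (c) (c2) (uc) edgeE => [|c0 [|c1 c']] //= _ /andP[c0c _] edgeE'.
  exists c0, (last c1 c'); split.
  - by rewrite inE eqxx.
  - by rewrite inE mem_last orbT.
  - by apply: contraNneq c0c => ->; exact: mem_last.
  - by rewrite edgeE' /joined inE eqxx.
  (* The pair closing the cycle has [vi] as its second component, hence the reversed disjunct of
     [joined]. *)
  rewrite edgeE' /joined; apply/orP; left; apply/orP; right.
  exact: (@mem_zip_last vi [:: c0, c1 & c'] vi).
have [t0 [t0t et0]] : exists t0, t0 \in t /\ edge vi t0.
  case: (t) (t1) edgeE => [//|t0 t'] _ edgeE'; exists t0; split.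
    by rewrite inE eqxx.
  by rewrite edgeE' /joined; apply/orP; right; rewrite /= inE eqxx.
have deg_vi : deg vi = 3%N.
  apply/eqP; rewrite eqn_leq; apply/andP; split.
    by apply: leq_trans (deg_le vi) _; rewrite eqxx (negPf vic) (negPf vit).
  apply: leq_trans (_ : #|[set c0; c1; t0]| <= _)%N.
    rewrite setUC cardsU1 cards2 c01 !inE.
    have ne x : x \in c -> (t0 == x) = false.
      by move=> xc; apply: contraTF t0t => /eqP->; exact: dis.
    by rewrite !ne.
  apply/subset_leq_card/subsetP => y; rewrite !inE.
  by move=> /orP[/orP[]|] /eqP->.
exists vi; split=> // [v vvi|s].
  apply: leq_trans (deg_le v) _; rewrite (negPf vvi) !add0n.
  by have [/dis/negPf->|_] := boolP (v \in c); case: (v \in t).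
have exit_le (p : seq G) y : y \in p -> edge vi y ->
    (#|nbrs vi :\: [set x in p]| <= 2)%N.
  move=> yp ey; rewrite -ltnS -deg_vi; apply/proper_card/properP.
  split; first exact: subsetDl.
  by exists y; rewrite !inE ?yp.
have [st|st] := boolP (s \in t).
  exists [set x in c]; split; rewrite ?inE //; last exact: exit_le c0c ec0.
    by apply/negP => /dis; rewrite st.
  move=> x y; rewrite !inE => xc yc; rewrite edgeE => /orP[] /orP[] /mem_zip[].
  - by rewrite mem_rcons inE (negPf yc) orbF => _ /eqP.
  - by rewrite inE (negPf yc) orbF => /eqP.
  - by rewrite inE (negPf (dis _ xc)) orbF => /eqP E; rewrite -E xc in vic.
  - by rewrite (negPf (dis _ xc)).
exists [set x in t]; split; rewrite ?inE //; last exact: exit_le t0t et0.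
move=> x y; rewrite !inE => xt yt; rewrite edgeE.
have xc : x \notin c by apply: contraL xt; exact: dis.
have xvi : x != vi by apply: contraTneq xt => ->.
case/orP=> /orP[] /mem_zip[].
- by rewrite inE (negPf xvi) (negPf xc).
- by rewrite mem_rcons inE (negPf xvi) (negPf xc).
- by rewrite (negPf yt).
- by rewrite inE (negPf yt) orbF => /eqP.
Qed.

End Tadpoles.

(** The lower bound [2 * M] on the optimum turns the cost bound of [ale_explores] into a ratio. A
    plan of the strategy exists because a complete run can be followed by shortest walks home. *)
Lemma ale_competitive_ratio (R : realType) (k : nat) : (3 <= k)%N ->
  competitive_ratio_le (@ale R) (@tadpole R) k (if odd k then 3 else 2).
Proof.
move=> k3 G s /tadpole_cut[vi [deg_vi deg_le2 /(_ s)[X [sX viX X_exit vi_exit]]]].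
have explore := ale_explores deg_vi deg_le2 sX viX X_exit vi_exit k3.
split=> [|P aP].
  have deg3 : (deg s <= 3)%N.
    by have [->|/deg_le2/leqW//] := eqVneq s vi; rewrite deg_vi.
  have [st0 init] := exists_initial deg3 k3.
  have [st re VT] := exists_ale_run deg_vi deg_le2 sX viX X_exit vi_exit k3 init.
  have [p pP] := choice (fun i => connected_walk (position s (history st) i) s).
  exists (fun i => history st i ++ walk (p i)), st0, st; split=> //.
    by left.
  by move=> i; exists (p i); rewrite // VT.
have [eP cP] := explore P aP; split=> //; apply: le_trans cP _.
by rewrite mulrC ler_wpM2l ?(radius_le_opt eP) //; case: ifP.
Qed.

Theorem theorem2 (R : realType) :
  competitive_ratio_le (@ale R) (@tadpole R) 3 3
  /\ competitive_ratio_le (@ale R) (@tadpole R) 4 2.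
Proof.
split; [exact: (@ale_competitive_ratio R 3)|exact: (@ale_competitive_ratio R 4)].
Qed.
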